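(* Let $(V_s,\oplus,\otimes)$ be an Einstein gyrovector space, let $A,B,C\in V_s$ be three non-gyrocollinear points (the vertices of gyrotriangle $ABC$), and let $P$ be a point of the gyroplane of $ABC$ lying on none of the gyrolines $AB$, $BC$, $CA$. Suppose that the gyrolines $AP$ and $BC$ meet at a point $A_1$, the gyrolines $BP$ and $CA$ meet at a point $B_1$, and the gyrolines $CP$ and $AB$ meet at a point $C_1$ (so that $A_1B_1C_1$ is the cevian gyrotriangle of the gyropoint $P$ with respect to the gyrotriangle $ABC$). Then $$\frac{\gamma_{|PA|}|PA|}{\gamma_{|PA_1|}|PA_1|}\cdot\frac{\gamma_{|PB|}|PB|}{\gamma_{|PB_1|}|PB_1|}\cdot\frac{\gamma_{|PC|}|PC|}{\gamma_{|PC_1|}|PC_1|}=\frac{\gamma_{|AB|}|AB|\cdot\gamma_{|BC|}|BC|\cdot\gamma_{|CA|}|CA|}{\gamma_{|AB_1|}|AB_1|\cdot\gamma_{|BC_1|}|BC_1|\cdot\gamma_{|CA_1|}|CA_1|}.$$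
   Context: Let $V$ be a real inner product space with inner product $\cdot$ and norm $\|\cdot\|$, let $s>0$, and let $V_s=\{\mathbf v\in V:\|\mathbf v\|<s\}$. For $\mathbf v\in V_s$ the gamma factor is $\gamma_{\mathbf v}=\left(1-\|\mathbf v\|^2/s^2\right)^{-1/2}$; since it depends only on the norm, for a real number $0\le r<s$ one writes likewise $\gamma_r=(1-r^2/s^2)^{-1/2}$. Einstein addition on $V_s$ is $$\mathbf u\oplus\mathbf v=\frac{1}{1+\frac{\mathbf u\cdot\mathbf v}{s^2}}\left\{\mathbf u+\frac{1}{\gamma_{\mathbf u}}\mathbf v+\frac{1}{s^2}\frac{\gamma_{\mathbf u}}{1+\gamma_{\mathbf u}}(\mathbf u\cdot\mathbf v)\mathbf u\right\},$$ and $\ominus\mathbf v=-\mathbf v$. Einstein scalar multiplication is $r\otimes\mathbf v=s\tanh\!\left(r\tanh^{-1}\frac{\|\mathbf v\|}{s}\right)\frac{\mathbf v}{\|\mathbf v\|}$ for $r\in\mathbb R$, $\mathbf v\neq\mathbf 0$, and $r\otimes\mathbf 0=\mathbf 0$. The triple $(V_s,\oplus,\otimes)$ is the Einstein gyrovector space (Einstein relativistic velocity model of hyperbolic geometry). The gyroline through two distinct points $X,Y\in V_s$ is $\{X\oplus\big(t\otimes(\ominus X\oplus Y)\big):t\in\mathbb R\}$, which is the intersection of $V_s$ with the Euclidean line through $X$ and $Y$. Points are gyrocollinear if they lie on a common gyroline. The gyroplane of a gyrotriangle $ABC$ is the intersection of $V_s$ with the affine plane through $A,B,C$. For $X,Y\in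 V_s$, $|XY|$ denotes the gyrodistance $|XY|=\|\ominus X\oplus Y\|$, and $\gamma_{|XY|}|XY|$ denotes the product of $\gamma_{|XY|}=\gamma_{\ominus X\oplus Y}$ and $|XY|$. *)

(* Defs.v *)
From HB Require Import structures.
From mathcomp Require Import all_boot all_order all_algebra.
From mathcomp Require Import classical_sets reals topology sequences exp.
From mathcomp Require Import ring lra.

Set Implicit Arguments.
Unset Strict Implicit.
Unset Printing Implicit Defensive.

Import Order.TTheory GRing.Theory Num.Theory.

Local Open Scope classical_set_scope.
Local Open Scope ring_scope.

Section HyperbolicTangent.
Context {R : realType}.
Implicit Types x y : R.

Definition tanh x : R := (expR x - expR (- x)) / (expR x + expR (- x)).

Definition artanh y : R := ln ((1 + y) / (1 - y)) / 2.

Let tanhE x : tanh x = (expR x ^+ 2 - 1) / (expR x ^+ 2 + 1).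
Proof.
have e0 : 0 < expR x by exact: expR_gt0.
rewrite /tanh expRN; field; apply/andP; split.
  by rewrite gt_eqF// ltr_wpDl ?exprn_ge0 ?ltW.
by rewrite gt_eqF.
Qed.

Lemma artanhK y : -1 < y < 1 -> tanh (artanh y) = y.
Proof.
move=> /andP[y1 y2].
have p1 : 0 < 1 + y by lra.
have p2 : 0 < 1 - y by lra.
have e2 : expR (artanh y) ^+ 2 = (1 + y) / (1 - y).
  have -> : artanh y = ln ((1 + y) / (1 - y)) / 2 by [].
  by rewrite -expRM_natl mulrC divfK ?pnatr_eq0// lnK// posrE divr_gt0.
rewrite tanhE e2; field; rewrite gt_eqF//=.
by rewrite (_ : _ + _ = 2) ?pnatr_eq0//; ring.
Qed.

Lemma tanhK x : artanh (tanh x) = x.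
Proof.
have q0 : 0 < expR x ^+ 2 by rewrite exprn_gt0 ?expR_gt0.
rewrite /artanh tanhE.
have -> : (1 + (expR x ^+ 2 - 1) / (expR x ^+ 2 + 1)) /
          (1 - (expR x ^+ 2 - 1) / (expR x ^+ 2 + 1)) = expR x ^+ 2.
  field; apply/andP; split; rewrite gt_eqF//; lra.
by rewrite -expRM_natl expRK mulrC mulKf ?pnatr_eq0.
Qed.

End HyperbolicTangent.

Section EinsteinGyrovectorSpace.
Context {R : realType} {V : lmodType R}.
Variables (dot : {dot V for idfun}) (s : R).
Implicit Types (u v X Y Z A B C : V) (r t : R).

(* [dot] is a real inner product: a symmetric, bilinear, positive definite form
   on a real vector space of any dimension. *)
Definition inorm v : R := Num.sqrt (dot v v).

(* Points of the space are the v : V with ball_s v; the operations below are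
   total on V and only meaningful on ball_s. *)
Definition ball_s : set V := [set v | inorm v < s].

Definition gammar r : R := (Num.sqrt (1 - r ^+ 2 / s ^+ 2))^-1.

Definition gamma v : R := gammar (inorm v).

Definition eadd u v : V :=
  (1 + dot u v / s ^+ 2)^-1 *:
    (u + (gamma u)^-1 *: v
       + (s ^- 2 * (gamma u / (1 + gamma u)) * dot u v) *: u).

Definition eopp v : V := - v.

Definition escale r v : V :=
  if v == 0 then 0
  else (s * tanh (r * artanh (inorm v / s))) *: ((inorm v)^-1 *: v).

(* Meaningful for X != Y only; gyroline X X is the singleton {X}. *)
Definition gyroline X Y : set V :=
  [set eadd X (escale t (eadd (eopp X) Y)) | t in [set: R]].

Definition gyrocollinear A B C : Prop :=
  exists X Y, [/\ ball_s X, ball_s Y, X != Y &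
    [/\ gyroline X Y A, gyroline X Y B & gyroline X Y C]].

Definition gyroplane A B C : set V :=
  ball_s `&` [set A + x *: (B - A) + y *: (C - A) | x in [set: R] & y in [set: R]].

Definition gyrodist X Y : R := inorm (eadd (eopp X) Y).

Definition gammadist X Y : R := gammar (gyrodist X Y) * gyrodist X Y.

End EinsteinGyrovectorSpace.

(* Main.v *)
Require Import Defs.
From HB Require Import structures.
From mathcomp Require Import all_boot all_order all_algebra.
From mathcomp Require Import classical_sets reals topology sequences exp.
From mathcomp Require Import ring lra.

Set Implicit Arguments.
Unset Strict Implicit.
Unset Printing Implicit Defensive.

Import Order.TTheory GRing.Theory Num.Theory.

Local Open Scope classical_set_scope.
Local Open Scope ring_scope.

(** The quantity [gammadist X Y = gamma * distance] is [s] times the hyperbolic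
    sine of the hyperbolic distance, and its square is
      [s^2 * ((1 - X.Y/s^2)^2 * gamma_X^2 * gamma_Y^2 - 1)].
    Once [gamma_X^2 * gamma_Y^2] is factored out, what remains is, up to sign and
    scale, the Gram determinant of the lifts [(s, X)] and [(s, Y)] in Minkowski
    space, i.e. a quadratic form in the bivector [(s, X) ^ (s, Y)].  If
    [Z = X + t(Y - X)], that bivector gets multiplied by [t], so
      [gammadist X Z = |t| * gamma_Z / gamma_Y * gammadist X Y]
    ([gammadist_line]): along a line, ratios of [gammadist] are Euclidean ratios
    up to the gamma factors of the end points.

    Gyrolines are chords of the ball: [gyroline_affine] and [affine_gyroline]
    identify the gyroline [X Y] with the points [X + t(Y - X)] of the ball.
    The problem thus becomes affine.  Write [P = aA + bB + cC] with
    [a + b + c = 1]; since [P] lies on none of the three lines, [a], [b], [c]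
    are nonzero and [A], [B], [C] are affinely independent.  The foot of the cevian
    from [A] is [(bB + cC)/(b + c)], whence
      [gammadist P A / gammadist P A1 = |(b + c)/a| * gamma_A / gamma_A1]
      [gammadist B C / gammadist C A1 = |(b + c)/b| * gamma_B / gamma_A1]
    ([cevian_ratio] and [foot_ratio]).  Multiplying each of these over the three
    cyclic permutations of the vertices gives the same product
      [|(b + c)(c + a)(a + b) / (abc)|]
    and the same gamma factors, which is the theorem. *)

(** * Inner product, ball and gamma factors *)

Section EinsteinGyrolines.
Context {R : realType} {V : lmodType R}.
Variables (dot : {dot V for idfun}) (s : R).
Hypothesis s_gt0 : 0 < s.
Implicit Types (u v w X Y Z P : V) (m r t : R).

Local Notation ball := (ball_s dot s).
Local Notation norm := (inorm dot).
Local Notation eadd := (eadd dot s).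
Local Notation escale := (escale dot s).
Local Notation gyroline := (gyroline dot s).
Local Notation gammadist := (gammadist dot s).

Lemma dotC u v : dot u v = dot v u.
Proof. by rewrite hermC/= mul1r. Qed.

Lemma dotDl u v w : dot (u + v) w = dot u w + dot v w.
Proof. exact: linearDl. Qed.

Lemma dotZl m u v : dot (m *: u) v = m * dot u v.
Proof. exact: linearZl_LR. Qed.

Lemma dotDr u v w : dot u (v + w) = dot u v + dot u w.
Proof. by rewrite dotC dotDl !(dotC u). Qed.

Lemma dotZr m u v : dot u (m *: v) = m * dot u v.
Proof. by rewrite dotC dotZl dotC. Qed.

Lemma dotNl u v : dot (- u) v = - dot u v.
Proof. by rewrite -scaleN1r dotZl mulN1r. Qed.

Lemma dotNr u v : dot u (- v) = - dot u v.
Proof. by rewrite dotC dotNl dotC. Qed.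

Lemma dot0r u : dot u 0 = 0.
Proof. by rewrite -(scale0r 0) dotZr mul0r. Qed.

Definition dotE := (dotDl, dotDr, dotNl, dotNr, dotZl, dotZr).

Lemma dot_ge0 u : 0 <= dot u u.
Proof.
have [->|u0] := eqVneq u 0; last exact/ltW/neq0_dnorm_gt0.
by rewrite dot0r.
Qed.

Lemma sqr_inorm u : norm u ^+ 2 = dot u u.
Proof. by rewrite sqr_sqrtr ?dot_ge0. Qed.

Lemma inorm_gt0 u : u != 0 -> 0 < norm u.
Proof. by move=> /neq0_dnorm_gt0 h; rewrite sqrtr_gt0; apply: h. Qed.

Lemma ball_sE u : ball u <-> dot u u < s ^+ 2.
Proof.
rewrite /ball_s/= -sqr_inorm ltr_pXn2r ?nnegrE ?sqrtr_ge0//; exact: ltW.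
Qed.

Lemma ball_opp u : ball u -> ball (- u).
Proof. by move=> /ball_sE uu; apply/ball_sE; rewrite !dotE opprK. Qed.

(** As [dot (u + v) (u + v)] is nonnegative, [- dot u v] is at most the mean of
    the two squared norms, which is less than [s ^+ 2]. *)
Lemma add1_dot_gt0 u v : ball u -> ball v -> 0 < 1 + dot u v / s ^+ 2.
Proof.
move=> /ball_sE uu /ball_sE vv.
have s2 : 0 < s ^+ 2 by rewrite exprn_gt0.
have := dot_ge0 (u + v); rewrite !dotE (dotC v u) => h.
have -> : 1 + dot u v / s ^+ 2 = (s ^+ 2 + dot u v) / s ^+ 2.
  by field; rewrite gt_eqF.
by rewrite divr_gt0//; lra.
Qed.

Lemma sub1_dot_gt0 u v : ball u -> ball v -> 0 < 1 - dot u v / s ^+ 2.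
Proof.
by move=> /ball_opp u' v'; have := add1_dot_gt0 u' v'; rewrite dotNl mulNr.
Qed.

Lemma sqs_add_dot_neq0 u v : ball u -> ball v -> s ^+ 2 + dot u v != 0.
Proof.
move=> bu bv; rewrite (_ : _ + _ = s ^+ 2 * (1 + dot u v / s ^+ 2)).
  by rewrite mulf_neq0 ?sqrf_eq0 ?gt_eqF ?add1_dot_gt0.
by field; rewrite gt_eqF.
Qed.

Lemma sqs_sub_dot_neq0 u v : ball u -> ball v -> s ^+ 2 - dot u v != 0.
Proof.
by move=> /ball_opp u' v'; have := sqs_add_dot_neq0 u' v'; rewrite dotNl.
Qed.

(** The inverse gamma factor.  It is a square root with polynomial square,
    which keeps the rational identities below within reach of [field]. *)
Definition igamma u : R := Num.sqrt (1 - dot u u / s ^+ 2).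

Lemma gammaE u : gamma dot s u = (igamma u)^-1.
Proof. by rewrite /gamma /gammar sqr_inorm. Qed.

Lemma igamma_gt0 u : ball u -> 0 < igamma u.
Proof. by move=> bu; rewrite sqrtr_gt0 sub1_dot_gt0. Qed.

Lemma sqr_igamma u : ball u -> igamma u ^+ 2 = 1 - dot u u / s ^+ 2.
Proof. by move=> bu; rewrite sqr_sqrtr// ltW// sub1_dot_gt0. Qed.

Lemma igamma_opp u : igamma (- u) = igamma u.
Proof. by rewrite /igamma !dotE opprK. Qed.

Lemma dot_igamma u : ball u -> dot u u = s ^+ 2 * (1 - igamma u ^+ 2).
Proof. by move=> bu; rewrite sqr_igamma//; field; rewrite gt_eqF. Qed.

(** * Einstein addition *)

(** Isolating the displacement from [u] turns the coefficient
    [gamma / (1 + gamma)] of the definition into [1 / (1 + igamma u)]. *)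
Lemma eaddE u v : ball u -> ball v ->
  eadd u v = u + (igamma u / (1 + dot u v / s ^+ 2)) *:
    (v - (dot u v / (s ^+ 2 * (1 + igamma u))) *: u).
Proof.
move=> bu bv; rewrite /Defs.eadd gammaE invrK.
have g0 := igamma_gt0 bu; have c0 := add1_dot_gt0 bu bv.
have ds0 := sqs_add_dot_neq0 bu bv.
rewrite [u + _ + _]addrAC -[X in X + _ *: u]scale1r -scalerDl scalerDr !scalerA.
rewrite scalerBr scalerA addrA addrAC -[X in _ = X - _ + _]scale1r -scalerBl.
congr (_ *: _ + _ *: _); last by rewrite mulrC.
by field; rewrite ds0 !gt_eqF// addr_gt0.
Qed.

(** This is the gamma identity: the gamma factor of a gyrosum is
    [gamma_u * gamma_v * (1 + u.v / s^2)]. *)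
Lemma dot_eadd u v : ball u -> ball v ->
  dot (eadd u v) (eadd u v) =
  s ^+ 2 * (1 - (igamma u * igamma v / (1 + dot u v / s ^+ 2)) ^+ 2).
Proof.
move=> bu bv; rewrite eaddE// !dotE (dotC v u).
have g0 := igamma_gt0 bu; have c0 := add1_dot_gt0 bu bv.
have ds0 := sqs_add_dot_neq0 bu bv.
rewrite (dot_igamma bu) (dot_igamma bv).
by field; rewrite ds0 !gt_eqF// addr_gt0.
Qed.

Lemma ball_eadd u v : ball u -> ball v -> ball (eadd u v).
Proof.
move=> bu bv; apply/ball_sE; rewrite dot_eadd// gtr_pMr ?exprn_gt0//.
by rewrite gtrBl exprn_gt0// divr_gt0 ?mulr_gt0 ?igamma_gt0// add1_dot_gt0.
Qed.

(** The gyrodifference is, up to a scalar, the image of [Y - X] under a linear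
    map that depends on [X] alone, so on a line through [X] all gyrodifferences
    from [X] are parallel. *)
Lemma eadd_opp X Y : ball X -> ball Y -> eadd (- X) Y =
  (1 - dot X Y / s ^+ 2)^-1 *: (igamma X *: (Y - X) +
     (dot X (Y - X) / (s ^+ 2 * (1 + igamma X))) *: X).
Proof.
move=> bX bY; have bX' := ball_opp bX.
have g0 := igamma_gt0 bX; have c0 := sub1_dot_gt0 bX bY.
have ds0 := sqs_sub_dot_neq0 bX bY.
rewrite eaddE// igamma_opp !dotE (dot_igamma bX).
have -> e d : - X + e *: (Y - d *: - X) = e *: Y + (e * d - 1) *: X.
  by rewrite scalerN opprK scalerDr scalerA scalerBl scale1r [LHS]addrC addrA.
have -> c g k :
    c *: (g *: (Y - X) + k *: X) = (c * g) *: Y + (c * (k - g)) *: X.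
  by rewrite scalerBr addrAC -addrA -scalerBl scalerDr !scalerA addrC.
have h : 1 - dot X Y / s ^+ 2 != 0 by rewrite gt_eqF.
by congr (_ *: _ + _ *: _); field; rewrite ?ds0 !gt_eqF// addr_gt0.
Qed.

(** This is why gyrolines are straight.  By [eaddE], adding [v] to [X] displaces
    [X] along [v - (dot X v / (s^2 * (1 + igamma X))) *: X].  For [v] the vector
    [igamma X *: (Y - X) + (dot X (Y - X) / (s^2 * (1 + igamma X))) *: X] of
    [eadd_opp] one has [dot X v = dot X (Y - X)], so the two multiples of [X]
    cancel and a multiple of [Y - X] remains. *)
Lemma eadd_scale_opp X Y m : ball X -> ball Y -> ball (m *: eadd (- X) Y) ->
  let w := m / (1 - dot X Y / s ^+ 2) in
  eadd X (m *: eadd (- X) Y) =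
  X + (w * igamma X ^+ 2 / (1 + w * dot X (Y - X) / s ^+ 2)) *: (Y - X).
Proof.
move=> bX bY bm w.
(* [Y - X] is kept opaque, so that the bilinear expansion does not split it. *)
have [D DE] : exists D, D = Y - X by exists (Y - X).
have mW : m *: eadd (- X) Y = w *: (igamma X *: D +
     (dot X D / (s ^+ 2 * (1 + igamma X))) *: X).
  by rewrite eadd_opp// scalerA DE.
have g0 := igamma_gt0 bX.
have s0 : s != 0 by rewrite gt_eqF.
have g1 : 1 + igamma X != 0 by rewrite gt_eqF// addr_gt0.
have XW : dot X (m *: eadd (- X) Y) = w * dot X D.
  by rewrite mW !dotE (dot_igamma bX); field; rewrite g1.
rewrite eaddE// XW mW -DE; congr (_ + _).
rewrite [w *: _]scalerDr !scalerA -addrA -scalerBl.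
rewrite (_ : w * (dot X D / _) - _ = 0); last by ring.
by rewrite scale0r addr0 scalerA; congr (_ *: _); ring.
Qed.

Lemma eaddKl X Y : ball X -> ball Y -> eadd X (eadd (- X) Y) = Y.
Proof.
move=> bX bY; have bW := ball_eadd (ball_opp bX) bY.
have := @eadd_scale_opp X Y 1 bX bY; rewrite scale1r => /(_ bW) ->.
rewrite (_ : _ / _ = 1); first by rewrite scale1r addrC subrK.
have g0 := igamma_gt0 bX; have c0 := sub1_dot_gt0 bX bY.
have s0 : s != 0 by rewrite gt_eqF.
have c : 1 - dot X Y / s ^+ 2 != 0 by rewrite gt_eqF.
rewrite (_ : 1 + _ = igamma X ^+ 2 / (1 - dot X Y / s ^+ 2)).
  rewrite div1r [_^-1 * _]mulrC divff// mulf_neq0 ?invr_neq0//.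
  by rewrite expf_neq0// gt_eqF.
by rewrite mul1r !dotE (dot_igamma bX); field; rewrite s0 sqs_sub_dot_neq0.
Qed.

(** * Gyrolines are chords of the ball *)

Lemma tanh_lt1 (x : R) : `|tanh x| < 1.
Proof.
have a := expR_gt0 x; have b := expR_gt0 (- x).
rewrite /tanh normrM normfV [X in _ / X]gtr0_norm ?addr_gt0//.
by rewrite ltr_pdivrMr ?addr_gt0// mul1r ltr_norml; apply/andP; split; lra.
Qed.

Lemma escaleP t v : exists m, escale t v = m *: v.
Proof.
rewrite /Defs.escale; case: eqP => _; last by eexists; rewrite scalerA.
by exists 0; rewrite scale0r.
Qed.

(** The unit vector of [v] gets multiplied by [s * tanh _], which is less than
    [s] in absolute value. *)
Lemma ball_escale t v : ball (escale t v).
Proof.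
have s2 : 0 < s ^+ 2 by rewrite exprn_gt0.
rewrite /Defs.escale; case: eqVneq => [_|v0]; apply/ball_sE.
  by rewrite dot0r.
rewrite !dotE -sqr_inorm; have n0 := inorm_gt0 v0.
rewrite (_ : _ * _ = s ^+ 2 * (tanh (t * artanh (norm v / s))) ^+ 2).
  by rewrite gtr_pMr// -real_normK ?num_real// expr_lt1// tanh_lt1.
by field; rewrite gt_eqF.
Qed.

(** As [t] varies, [tanh (t * artanh (norm v / s))] takes every value in
    ]-1, 1[, because [artanh (norm v / s)] is nonzero. *)
Lemma escale_surj v m : ball v -> ball (m *: v) ->
  exists t, escale t v = m *: v.
Proof.
move=> /ball_sE bv; have [->|v0] := eqVneq v 0.
  by move=> _; exists 0; rewrite scaler0 /Defs.escale eqxx.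
have n0 := inorm_gt0 v0.
have lt1 k : k ^+ 2 * norm v ^+ 2 < s ^+ 2 -> -1 < k * norm v / s < 1.
  rewrite -exprMn => h; rewrite -ltr_norml normrM.
  rewrite [`|s^-1|]gtr0_norm ?invr_gt0//.
  rewrite ltr_pdivrMr// mul1r -(@ltr_pXn2r _ 2) ?nnegrE ?(ltW s_gt0)//.
  by rewrite real_normK ?num_real.
move=> /ball_sE; rewrite !dotE mulrA -expr2 -sqr_inorm => /lt1 hm.
have h1 : -1 < norm v / s < 1.
  by have := lt1 1; rewrite expr1n !mul1r; apply; rewrite sqr_inorm.
have a0 : artanh (norm v / s) != 0.
  apply/eqP => h; have := artanhK h1.
  rewrite h /tanh oppr0 subrr mul0r => /esym/eqP.
  by rewrite mulf_eq0 invr_eq0 !gt_eqF.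
exists (artanh (m * norm v / s) / artanh (norm v / s)).
rewrite /Defs.escale (negPf v0) divfK// artanhK// scalerA; congr (_ *: _).
by field; rewrite !gt_eqF.
Qed.

Lemma gyroline_affine X Y Z : ball X -> ball Y -> gyroline X Y Z ->
  ball Z /\ exists t, Z = X + t *: (Y - X).
Proof.
move=> bX bY [t _ <-]; have [m mE] := escaleP t (eadd (- X) Y).
have bm := ball_escale t (eadd (- X) Y); split; first exact: ball_eadd.
by rewrite mE in bm *; rewrite eadd_scale_opp//; eexists.
Qed.

(** The parameter is found from left cancellation: [Z] equals [X] plus the
    gyrodifference from [X] to [Z], which is a multiple [m] of the one to [Y] by
    [eadd_opp], and every multiple in the ball is an [escale]. *)
Lemma affine_gyroline X Y t : ball X -> ball Y -> ball (X + t *: (Y - X)) ->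
  gyroline X Y (X + t *: (Y - X)).
Proof.
set Z := X + _ => bX bY bZ.
have ZX : Z - X = t *: (Y - X) by rewrite addrC addKr.
have bX' := ball_opp bX; have cY := sub1_dot_gt0 bX bY.
pose m := t * (1 - dot X Y / s ^+ 2) / (1 - dot X Z / s ^+ 2).
have mE : eadd (- X) Z = m *: eadd (- X) Y.
  rewrite !eadd_opp// ZX dotZr [RHS]scalerA.
  have cY0 : 1 - dot X Y / s ^+ 2 != 0 by rewrite gt_eqF.
  have -> : m / (1 - dot X Y / s ^+ 2) = (1 - dot X Z / s ^+ 2)^-1 * t.
    by rewrite /m mulrAC mulfK// mulrC.
  rewrite -[RHS]scalerA; congr (_ *: _).
  by rewrite [RHS]scalerDr !scalerA [t * igamma X]mulrC (mulrA t).
have [|r rE] := @escale_surj (eadd (- X) Y) m (ball_eadd bX' bY).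
  by rewrite -mE; exact: ball_eadd.
by exists r => //; rewrite rE -mE eaddKl.
Qed.

(** * The distance function along a line *)

Lemma gammadistE X Y :
  gammadist X Y = (igamma (eadd (- X) Y))^-1 * norm (eadd (- X) Y).
Proof. by rewrite -gammaE. Qed.

Lemma sqr_gammadist X Y : ball X -> ball Y -> gammadist X Y ^+ 2 =
  s ^+ 2 * ((1 - dot X Y / s ^+ 2) ^+ 2 / (igamma X ^+ 2 * igamma Y ^+ 2) - 1).
Proof.
move=> bX bY; have bX' := ball_opp bX; have bW := ball_eadd bX' bY.
rewrite gammadistE.
have c0 := sub1_dot_gt0 bX bY.
have c : 1 - dot X Y / s ^+ 2 != 0 by rewrite gt_eqF.
rewrite exprMn sqr_inorm exprVn.
rewrite (sqr_igamma bW) dot_eadd// igamma_opp !dotE mulNr.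
have gX := igamma_gt0 bX; have gY := igamma_gt0 bY.
(* A variable [k] spares [field] the fraction inside this denominator. *)
set k := 1 - dot X Y / _ in c *; clearbody k.
have gX0 : igamma X != 0 by rewrite gt_eqF.
have gY0 : igamma Y != 0 by rewrite gt_eqF.
have s0 : s != 0 by rewrite gt_eqF.
set q := igamma X * igamma Y / k.
rewrite (_ : 1 - s ^+ 2 * (1 - q ^+ 2) / s ^+ 2 = q ^+ 2); last by field.
by rewrite /q; field; rewrite c gX0 gY0.
Qed.

Lemma gammadist_ge0 X Y : ball X -> ball Y -> 0 <= gammadist X Y.
Proof. by move=> bX bY; rewrite mulr_ge0 ?invr_ge0 ?sqrtr_ge0. Qed.

Lemma eq_gammadist X Y r : ball X -> ball Y -> 0 <= r ->
  gammadist X Y ^+ 2 = r ^+ 2 -> gammadist X Y = r.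
Proof.
move=> bX bY r0 /eqP; rewrite eqrXn2 ?gammadist_ge0// => /eqP; exact.
Qed.

Lemma gammadistC X Y : ball X -> ball Y -> gammadist X Y = gammadist Y X.
Proof.
move=> bX bY; apply: eq_gammadist; rewrite ?gammadist_ge0// !sqr_gammadist//.
by rewrite dotC [_ * igamma Y ^+ 2]mulrC.
Qed.

Lemma gammadist_neq0 X Y : ball X -> ball Y -> X != Y -> gammadist X Y != 0.
Proof.
move=> bX bY; apply: contra; have bW := ball_eadd (ball_opp bX) bY.
rewrite gammadistE mulf_eq0 invr_eq0 (gt_eqF (igamma_gt0 bW))/= => n0.
have W0 : eadd (- X) Y = 0.
  by have [//|/inorm_gt0] := eqVneq (eadd (- X) Y) 0; rewrite (eqP n0) ltxx.
rewrite W0 in bW; have := eaddKl bX bY; rewrite W0 => <-.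
by rewrite eaddE// dot0r !mul0r scale0r subr0 scaler0 addr0.
Qed.

(** Up to gamma factors, both squares are Gram determinants of two lifted points,
    and that of [X] and [Z] is [t ^+ 2] times that of [X] and [Y], because the
    lift of [Z] is the lift of [X] plus [t] times the difference of lifts. *)
Lemma gammadist_line X Y t : ball X -> ball Y -> ball (X + t *: (Y - X)) ->
  gammadist X (X + t *: (Y - X)) =
  `|t| * (igamma Y / igamma (X + t *: (Y - X))) * gammadist X Y.
Proof.
set Z := X + _ => bX bY bZ.
have gX := igamma_gt0 bX; have gY := igamma_gt0 bY; have gZ := igamma_gt0 bZ.
apply: eq_gammadist => //.
  by apply: mulr_ge0; [rewrite mulr_ge0// divr_ge0// ltW|exact: gammadist_ge0].
rewrite [LHS]sqr_gammadist// [RHS]exprMn sqr_gammadist//.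
rewrite !exprMn real_normK ?num_real//.
(* [Z] is expanded only after its gamma factor has been cancelled, so that its
   denominator is not expanded in [t]. *)
pose gram W := (1 - dot X W / s ^+ 2) ^+ 2 / igamma X ^+ 2 - igamma W ^+ 2.
rewrite [RHS](_ : _ = t ^+ 2 * s ^+ 2 * gram Y / igamma Z ^+ 2); last first.
  by rewrite /gram; field; rewrite !gt_eqF.
rewrite [LHS](_ : _ = s ^+ 2 * gram Z / igamma Z ^+ 2); last first.
  by rewrite /gram; field; rewrite !gt_eqF.
congr (_ / _); rewrite /gram (sqr_igamma bY) (sqr_igamma bZ) /Z !dotE.
rewrite (dotC Y X) (dot_igamma bX).
by field; rewrite !gt_eqF.
Qed.

(** * Barycentric coordinates of a point off the side lines *)

Lemma affineE X Y t : X + t *: (Y - X) = (1 - t) *: X + t *: Y.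
Proof. by rewrite scalerBr scalerBl scale1r addrCA addrC. Qed.

Lemma sum_neq_off_gyroline X Y P a b : ball X -> ball Y -> ball P ->
  ~ gyroline X Y P -> a + b = 1 -> P <> a *: X + b *: Y.
Proof.
move=> bX bY bP off ab PE; apply: off.
have E : P = X + b *: (Y - X) by rewrite affineE PE -ab addrK.
by rewrite E; apply: affine_gyroline; rewrite -?E.
Qed.

Lemma off_gyroline_coord X Y Z P a b c : ball Y -> ball Z -> ball P ->
  ~ gyroline Y Z P -> a + b + c = 1 -> P = a *: X + b *: Y + c *: Z -> a != 0.
Proof.
move=> bY bZ bP off abc PE; apply/eqP => a0; move: abc PE.
by rewrite a0 scale0r !add0r => bc; apply: sum_neq_off_gyroline.
Qed.

(** A relation involving [X] would express [X], hence [P], as an affine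
    combination of [Y] and [Z]. *)
Lemma off_gyroline_relation X Y Z P a b c p q r : ball Y -> ball Z -> ball P ->
  ~ gyroline Y Z P -> a + b + c = 1 -> P = a *: X + b *: Y + c *: Z ->
  p + q + r = 0 -> p *: X + q *: Y + r *: Z = 0 -> p = 0.
Proof.
move=> bY bZ bP off abc PE pqr E; apply/eqP/negPn/negP => p0.
pose m := a / p.
apply: (sum_neq_off_gyroline bY bZ bP off (a := b - m * q) (b := c - m * r)).
  rewrite (_ : _ + _ = (a + b + c) - m * (p + q + r)).
    by rewrite abc pqr mulr0 subr0.
  by rewrite /m; field.
have pX : p *: X = - (q *: Y + r *: Z) by apply/eqP; rewrite -addr_eq0 addrA E.
rewrite PE -(divfK p0 a) -[(_ * p) *: X]scalerA pX -/m.
rewrite scalerN scalerDr !scalerA.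
by rewrite !scalerBl [RHS]addrACA -opprD [RHS]addrC addrA.
Qed.

Definition affinely_free X Y Z := forall a b c, a + b + c = 0 ->
  a *: X + b *: Y + c *: Z = 0 -> [/\ a = 0, b = 0 & c = 0].

Lemma affinely_free_rot X Y Z : affinely_free X Y Z -> affinely_free Y Z X.
Proof.
move=> f a b c abc E.
have [||c0 a0 b0] := f c a b; last by split.
  by rewrite -abc; ring.
by rewrite -addrA addrC.
Qed.

(** * The foot of a cevian *)

Section Cevian.
Variables (X Y Z P F : V) (a b c : R).
Hypotheses (bX : ball X) (bY : ball Y) (bZ : ball Z) (bP : ball P).
Hypothesis free : affinely_free X Y Z.
Hypotheses (abc : a + b + c = 1) (PE : P = a *: X + b *: Y + c *: Z).
Hypotheses (a0 : a != 0) (b0 : b != 0).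
Hypotheses (FXP : gyroline X P F) (FYZ : gyroline Y Z F).

Let bF : ball F. Proof. by have [] := gyroline_affine bY bZ FYZ. Qed.

(** Comparing the coordinates of [F] on [X P] and on [Y Z] gives
    [F = (b *: Y + c *: Z) / (b + c)]; here [t] is [(b + c)^-1], stated without
    inverse because [b + c != 0] is part of the conclusion. *)
Let foot_coords : exists t, [/\ t * (b + c) = 1,
  F = P + (- (t * a)) *: (X - P) & F = Z + (t * b) *: (Y - Z)].
Proof.
have [_ [t Ft]] := gyroline_affine bX bP FXP.
have [_ [u Fu]] := gyroline_affine bY bZ FYZ.
(* These are the coordinates of the difference of the two expressions of [F]. *)
have [||ht hb hc] := free (a := 1 - t + t * a) (b := t * b - (1 - u))
                          (c := t * c - u).
- rewrite [LHS](_ : _ = t * (a + b + c) - t); last by ring.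
  by rewrite abc mulr1 subrr.
- move: Ft; rewrite affineE PE !scalerDr !scalerA !addrA => Ft.
  rewrite -(subrr F) {1}Ft Fu affineE.
  set e := 1 - t; set f := 1 - u; rewrite scalerDl.
  rewrite [(_ - f) *: Y]scalerBl [(_ - u) *: Z]scalerBl opprD -!addrA.
  by congr (_ + (_ + (_ + _))); rewrite addrCA.
exists t; split.
- have -> : b + c = 1 - a by rewrite -abc; ring.
  by apply/eqP; rewrite -subr_eq0 -oppr_eq0 -ht; apply/eqP; ring.
- have -> : - (t * a) = 1 - t by rewrite -[LHS]addr0 -ht; ring.
  by rewrite affineE subKr Ft affineE addrC.
- have -> : t * b = 1 - u by apply/eqP; rewrite -subr_eq0 hb.
  by rewrite affineE subKr Fu affineE addrC.
Qed.

Lemma cevian_ratio :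
  gammadist P X / gammadist P F = `|(b + c) / a| * (igamma F / igamma X).
Proof.
have [t [tbc FP _]] := foot_coords.
have PX : gammadist P X != 0.
  apply: gammadist_neq0 => //; apply/eqP => PX.
  have [||_ /eqP] := free (a := a - 1) (b := b) (c := c); rewrite ?(negPf b0)//.
    by rewrite -abc; ring.
  by rewrite scalerBl scale1r -2!addrA [- X + _]addrC 2!addrA -PE PX subrr.
have t0 : t != 0.
  by apply: contra_eq_neq tbc => ->; rewrite mul0r eq_sym oner_neq0.
have -> : b + c = t^-1 by rewrite -[LHS](mulKf t0) tbc mulr1.
have [gX gF] := (igamma_gt0 bX, igamma_gt0 bF).
have -> : gammadist P F = `|- (t * a)| * (igamma X / igamma F) * gammadist P X.
  by rewrite {1}FP gammadist_line -?FP.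
rewrite normrN !normrM !normfV; field.
by rewrite PX !normr_eq0 a0 t0 !gt_eqF.
Qed.

Lemma foot_ratio :
  gammadist Y Z / gammadist Z F = `|(b + c) / b| * (igamma F / igamma Y).
Proof.
have [t [tbc _ FZ]] := foot_coords.
have ZY : gammadist Z Y != 0.
  apply: gammadist_neq0 => //; apply/eqP => ZY.
  have [||_ /eqP] := free (a := 0) (b := 1) (c := -1); rewrite ?oner_eq0//.
    by rewrite add0r subrr.
  by rewrite ZY scale0r add0r scaleN1r scale1r subrr.
have t0 : t != 0.
  by apply: contra_eq_neq tbc => ->; rewrite mul0r eq_sym oner_neq0.
have -> : b + c = t^-1 by rewrite -[LHS](mulKf t0) tbc mulr1.
have [gY gF] := (igamma_gt0 bY, igamma_gt0 bF).
have -> : gammadist Z F = `|t * b| * (igamma Y / igamma F) * gammadist Z Y.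
  by rewrite {1}FZ gammadist_line -?FZ.
rewrite gammadistC// !normrM !normfV; field.
by rewrite ZY !normr_eq0 b0 t0 !gt_eqF.
Qed.

End Cevian.

End EinsteinGyrolines.

Theorem theorem3 (R : realType) (V : lmodType R) (dot : {dot V for idfun})
    (s : R) (hs : 0 < s) (A B C P A1 B1 C1 : V)
    (hA : ball_s dot s A) (hB : ball_s dot s B) (hC : ball_s dot s C)
    (hABC : ~ gyrocollinear dot s A B C)
    (hP : gyroplane dot s A B C P)
    (hPAB : ~ gyroline dot s A B P)
    (hPBC : ~ gyroline dot s B C P)
    (hPCA : ~ gyroline dot s C A P)
    (hA1 : (gyroline dot s A P `&` gyroline dot s B C) A1)
    (hB1 : (gyroline dot s B P `&` gyroline dot s C A) B1)
    (hC1 : (gyroline dot s C P `&` gyroline dot s A B) C1) :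
  let gd := gammadist dot s in
  (gd P A / gd P A1) * (gd P B / gd P B1) * (gd P C / gd P C1) =
  (gd A B * gd B C * gd C A) / (gd A B1 * gd B C1 * gd C A1).
Proof.
move=> gd; rewrite {}/gd.
have [bP [x _ [y _ PE]]] := hP.
pose a := 1 - x - y.
have abc : a + x + y = 1 by rewrite /a; ring.
have {}PE : P = a *: A + x *: B + y *: C.
  rewrite -PE scalerBl affineE scalerBr addrA [LHS]addrAC; congr (_ + _).
  by rewrite addrAC.
have bca : x + y + a = 1 by rewrite addrC addrA.
have cab : y + a + x = 1 by rewrite addrC addrA.
have PE' : P = x *: B + y *: C + a *: A by rewrite PE -addrA addrC.
have PE'' : P = y *: C + a *: A + x *: B by rewrite PE addrC addrA.
have free : affinely_free A B C.
  move=> p q r pqr E; split.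
  - exact: (off_gyroline_relation hs hB hC bP hPBC abc PE pqr E).
  - apply: (off_gyroline_relation hs hC hA bP hPCA bca PE' (q := r) (r := p)).
      by rewrite addrC addrA.
    by rewrite -E [RHS]addrC addrA [RHS]addrC addrA addrC addrA.
  - apply: (off_gyroline_relation hs hA hB bP hPAB cab PE'' (q := p) (r := q)).
      by rewrite -addrA addrC.
    by rewrite -addrA addrC.
have a0 := off_gyroline_coord hs hB hC bP hPBC abc PE.
have x0 := off_gyroline_coord hs hC hA bP hPCA bca PE'.
have y0 := off_gyroline_coord hs hA hB bP hPAB cab PE''.
have fB := affinely_free_rot free; have fC := affinely_free_rot fB.
have [A1P A1E] := hA1; have [B1P B1E] := hB1; have [C1P C1E] := hC1.
rewrite (cevian_ratio hs hA hB hC bP free abc PE a0 x0 A1P A1E).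
rewrite (cevian_ratio hs hB hC hA bP fB bca PE' x0 y0 B1P B1E).
rewrite (cevian_ratio hs hC hA hB bP fC cab PE'' y0 a0 C1P C1E).
(* The right-hand side is regrouped by feet, as the left-hand side is. *)
transitivity ((gammadist dot s B C / gammadist dot s C A1) *
  (gammadist dot s C A / gammadist dot s A B1) *
  (gammadist dot s A B / gammadist dot s B C1)); last first.
  by rewrite !invfM; ring.
rewrite (foot_ratio hs hA hB hC bP free abc PE x0 A1P A1E).
rewrite (foot_ratio hs hB hC hA bP fB bca PE' y0 B1P B1E).
rewrite (foot_ratio hs hC hA hB bP fC cab PE'' a0 C1P C1E).
by rewrite !normrM; ring.
Qed.
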